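(* Let $S$ be a two-distance set in the unit sphere $\mathbb S^{d-1}$ of $\mathbb R^d$ with $|S|=d+k$, $k\ge1$, and with minimum distance $a=\sqrt2$. Then $S=S_1*\cdots*S_m$ for some subsets $S_1,\dots,S_m$ such that all $S_i$ are J-prime and exactly $k$ of them are of Type I.
   Context: A two-distance set with distances $a\le b$ is a finite set in which any two distinct points are at distance $a$ or $b$. The unit sphere $\mathbb S^{d-1}\subset\mathbb R^d$ is centered at the origin $O$. Join: the join $X*Y\subset\mathbb R^{p+q}$ of $X\subset\mathbb R^p$ and $Y\subset\mathbb R^q$ is obtained by placing $X$ in the first $p$ coordinates and $Y$ in the last $q$ coordinates of $\mathbb R^{p+q}$ and taking the union; geometrically, the two sets are put in orthogonal linear subspaces. Accordingly, for $S\subset\mathbb R^d$, $S=S_1*\cdots*S_m$ means that $\mathbb R^d$ is the orthogonal direct sum of nonzero linear subspaces $L_1,\dots,L_m$ with $\emptyset\neq S_i\subset L_i$ and $S=S_1\cup\dots\cup S_m$; each $S_i$ is then regarded as a subset of the Euclidean space $L_i$. A set is J-prime (join-indecomposable) if it is not the join of two nonempty sets in this sense. Type I: a join-indecomposable set $T$ in the unit sphere $\mathbb S^{e-1}$ of an $e$-dimensional Euclidean space is of Type I if $|T|=e+1$, the affine hull of $T$ has dimension $e$, and the center $O$ of $\mathbb S^{e-1}$ lies in the interior of the convex hull of $T$. (Here $e=\dim L_i$ when $T=S_i$.) *)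

(* Defs.v *)
From HB Require Import structures.
From mathcomp Require Import all_boot all_order all_algebra finmap.
From mathcomp Require Import all_classical all_reals all_analysis.

Set Implicit Arguments.
Unset Strict Implicit.
Unset Printing Implicit Defensive.

Import Order.TTheory GRing.Theory Num.Theory.
Import numFieldNormedType.Exports.

Local Open Scope classical_set_scope.
Local Open Scope ring_scope.

(* Points of R^d are row vectors. The library norm on 'rV[R]_d is the sup     *)
(* norm, so the Euclidean norm is defined here; the library topology on       *)
(* 'rV[R]_d is the product topology, which is the Euclidean one.              *)
Section Euclidean.
Variables (R : realType) (d : nat).
Local Notation V := 'rV[R]_d.
Implicit Types (u v x : V) (L M : {vspace V}) (S T : {fset V}) (A : set V).

Definition dot u v : R := \sum_(j < d) u 0 j * v 0 j.
Definition enorm u : R := Num.sqrt (dot u u).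
Definition edist u v : R := enorm (u - v).

Definition unit_sphere : set V := [set x | enorm x = 1].

(* The distances a and b are not both required to occur. *)
Definition two_distance_set (a b : R) S : Prop :=
  a <= b /\
  forall x y, x \in S -> y \in S -> x != y -> edist x y = a \/ edist x y = b.

Definition orthogonal_spaces L M : Prop :=
  forall u v, u \in L -> v \in M -> dot u v = 0.

Definition orthogonal_direct_sum M m (L : 'I_m -> {vspace V}) : Prop :=
  [/\ (\sum_(i < m) L i)%VS = M,
      directv (\sum_(i < m) L i)
    & forall i j, i != j -> orthogonal_spaces (L i) (L j)].

(* S, regarded as a subset of the Euclidean space M, is T_0 * ... * T_(m-1),  *)
(* with T_i placed in the summand L_i of M.                                   *)
Definition is_join M S m (L : 'I_m -> {vspace V}) (T : 'I_m -> {fset V})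
  : Prop :=
  [/\ orthogonal_direct_sum M L,
      forall i, L i != 0%VS,
      forall i, T i != fset0,
      forall i x, x \in T i -> x \in L i
    & [set` S] = \bigcup_(i in [set: 'I_m]) [set` T i]].

Definition J_prime M S : Prop :=
  ~ exists (L : 'I_2 -> {vspace V}) (T : 'I_2 -> {fset V}), is_join M S L T.

Definition affine_hull T : set V :=
  [set x | exists w : V -> R,
     \sum_(t <- T) w t = 1 /\ x = \sum_(t <- T) w t *: t].

Definition conv_hull T : set V :=
  [set x | exists w : V -> R,
     [/\ forall t, t \in T -> 0 <= w t, \sum_(t <- T) w t = 1
       & x = \sum_(t <- T) w t *: t]].

Definition affine_dim A (n : nat) : Prop :=
  exists (p : V) (W : {vspace V}),
    A = [set p + w | w in [set w | w \in W]] /\ \dim W = n.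

Definition interior_in M A : set V :=
  [set x : V | x \in M /\ within [set y : V | y \in M] (nbhs x) A].

Definition type_I M T : Prop :=
  [/\ J_prime M T,
      forall x, x \in T -> x \in M /\ unit_sphere x,
      #|` T| = (\dim M).+1,
      affine_dim (affine_hull T) (\dim M)
    & interior_in M (conv_hull T) 0].

End Euclidean.

(* Main.v *)
Require Import Defs.
From HB Require Import structures.
From mathcomp Require Import all_boot all_order all_algebra finmap.
From mathcomp Require Import all_classical all_reals all_analysis.
From mathcomp Require Import lra.
Set Implicit Arguments.
Unset Strict Implicit.
Unset Printing Implicit Defensive.
Import Order.TTheory GRing.Theory Num.Theory.
Import numFieldNormedType.Exports.
Local Open Scope classical_set_scope.
Local Open Scope ring_scope.

(** Unit vectors at distance at least [sqrt 2] have a nonpositive inner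
    product, so any two points of [S] form an angle of at least 90 degrees. Split
    [S] into the connected components [T_i] of the graph that joins two points
    when their inner product is nonzero. Distinct components are orthogonal,
    and a connected set is never the union of two nonempty orthogonal parts, so
    each [T_i] is J-prime whatever space it is regarded in
    ([orth_components], [orth_connected_J_prime]).

    The key fact concerns linear relations in a connected set [T] with
    nonpositive inner products. If [sum c_t t = 0], then replacing each [c_t]
    by its absolute value can only decrease the off-diagonal terms of the
    squared norm, so [sum |c_t| t = 0] as well; pairing this with a point where
    [c] vanishes shows that this point is orthogonal to the support of [c].
    Hence a nontrivial relation has full support
    ([connected_relation_support]). Two consequences follow. Dropping one point
    of [T] leaves a free family, so [dim <<T>> >= |T| - 1]. And if [T] is
    dependent, then [0] is a combination of all of its points with positive
    weights, so it is interior to the convex hull of [T] relative to [<<T>>],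
    and [T] is of Type I in its span ([dependent_type_I]).

    The spans [<<T_i>>] need not fill the whole space, so the spaces [L_i] are
    obtained from them by adding missing orthogonal directions one at a time,
    always to a space with [dim L_i < |T_i|]; since [d <= |S|], such a space
    exists as long as the sum is not everything ([enlarge_to_full]). In the end
    [|T_i| - 1 <= dim L_i <= |T_i|], the set [T_i] is of Type I exactly when
    the first inequality is an equality, and summing [|T_i| - dim L_i] over [i]
    gives [|S| - d = k] sets of Type I. *)

(** * The Euclidean inner product *)

Section Dot.
Variables (R : realType) (d : nat).
Local Notation V := 'rV[R]_d.
Implicit Types (u v w : V) (U : {vspace V}).

Lemma dotC u v : dot u v = dot v u.
Proof. by apply: eq_bigr => j _; rewrite mulrC. Qed.

Lemma dotDl u v w : dot (u + v) w = dot u w + dot v w.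
Proof. by rewrite -big_split; apply: eq_bigr => j _; rewrite mxE mulrDl. Qed.

Lemma dotZl (a : R) u w : dot (a *: u) w = a * dot u w.
Proof. by rewrite /dot mulr_sumr; apply: eq_bigr => j _; rewrite mxE mulrA. Qed.

Lemma dot0l w : dot 0 w = 0.
Proof. by rewrite -(scale0r 0) dotZl mul0r. Qed.

Lemma dotZr (a : R) u w : dot w (a *: u) = a * dot w u.
Proof. by rewrite dotC dotZl dotC. Qed.

Lemma dotDr u v w : dot w (u + v) = dot w u + dot w v.
Proof. by rewrite dotC dotDl !(dotC w). Qed.

Lemma dot_suml (I : Type) (r : seq I) (P : pred I) (F : I -> V) w :
  dot (\sum_(i <- r | P i) F i) w = \sum_(i <- r | P i) dot (F i) w.
Proof.
by apply: (big_morph (fun u => dot u w)) => [u v|]; rewrite ?dotDl ?dot0l.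
Qed.

Lemma dot_sumr (I : Type) (r : seq I) (P : pred I) (F : I -> V) w :
  dot w (\sum_(i <- r | P i) F i) = \sum_(i <- r | P i) dot w (F i).
Proof. by rewrite dotC dot_suml; apply: eq_bigr => i _; rewrite dotC. Qed.

Lemma dot_ge0 u : 0 <= dot u u.
Proof. by apply: sumr_ge0 => j _; rewrite -expr2 sqr_ge0. Qed.

Lemma dot_eq0 u : dot u u = 0 -> u = 0.
Proof.
move=> /psumr_eq0P u0; apply/rowP => j; rewrite mxE.
by apply/eqP; rewrite -sqrf_eq0 expr2 u0 // => i _; rewrite -expr2 sqr_ge0.
Qed.

Lemma unit_sphere_dot u : unit_sphere u -> dot u u = 1.
Proof.
by rewrite /unit_sphere /= /enorm => u1; rewrite -(sqr_sqrtr (dot_ge0 u)) u1 expr1n.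
Qed.

(** A vector orthogonal to a basis of [U] is a row killed by the matrix whose
    columns are that basis; this matrix has fewer columns than rows. *)
Lemma exists_orthogonal U : U != fullv ->
  exists2 w, w != 0 & forall u, u \in U -> dot u w = 0.
Proof.
move=> Unf; pose A : 'M[R]_(d, \dim U) := \matrix_(i, j) (vbasis U)`_j 0 i.
have ltUd : (\dim U < d)%N.
  have := dimvS (subvf U); rewrite leq_eqVlt dimvf /dim /= mul1n.
  case/orP=> // /eqP dU; case/eqP: Unf; apply/eqP.
  by rewrite eqEdim subvf dimvf /dim /= mul1n dU leqnn.
have kn0 : kermx A != 0.
  rewrite -mxrank_eq0 mxrank_ker -lt0n subn_gt0.
  exact: leq_ltn_trans (rank_leq_col A) ltUd.
exists (nz_row (kermx A)); first by rewrite nz_row_eq0.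
move=> u /coord_vbasis ->; rewrite dot_suml big1 // => j _; rewrite dotZl.
have /sub_kermxP/matrixP/(_ 0 j) := nz_row_sub (kermx A).
rewrite !mxE => e; apply/eqP; rewrite mulf_eq0; apply/orP; right.
apply/eqP; rewrite -[RHS]e /dot; apply: eq_bigr => i _.
by rewrite !mxE mulrC.
Qed.

Lemma orthogonal_directv m (L : 'I_m -> {vspace V}) :
  (forall i j, i != j -> orthogonal_spaces (L i) (L j)) ->
  directv (\sum_(i < m) L i).
Proof.
move=> orL; apply/directv_sum_independent => us usL us0 i _.
apply: dot_eq0; have := congr1 (dot (us i)) us0.
rewrite dot_sumr (bigD1 i) //= big1 ?addr0 => [->|j ji].
  by rewrite dotC dot0l.
by apply: (orL i j) => //; [rewrite eq_sym|exact: usL|exact: usL].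
Qed.

(** Freeness and coordinates are indexed by positions in a sequence, whereas
    affine and convex combinations are weighted by functions of the vector; this
    passes from the former to the latter. Being a sum, the result visibly depends
    continuously on parameters of [k]. *)
Definition coef_at (X : seq V) (k : 'I_(size X) -> R) (t : V) : R :=
  \sum_(j < size X | X`_j == t) k j.

Lemma coef_at_nth (X : seq V) (k : 'I_(size X) -> R) (j : 'I_(size X)) :
  uniq X -> coef_at k X`_j = k j.
Proof.
by move=> uX; rewrite /coef_at (big_pred1 j) // => l /=; rewrite nth_uniq.
Qed.

Lemma sum_coef_at (X : seq V) (k : 'I_(size X) -> R) : uniq X ->
  \sum_(t <- X) coef_at k t *: t = \sum_(i < size X) k i *: X`_i.
Proof.
move=> uX; rewrite (big_nth 0) big_mkord.
by apply: eq_bigr => j _; rewrite coef_at_nth.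
Qed.

Lemma free_relations (X : seq V) : uniq X ->
  (forall c : V -> R, \sum_(t <- X) c t *: t = 0 ->
     forall t, t \in X -> c t = 0) ->
  free X.
Proof.
move=> uX triv; apply/(@freeP _ _ _ (in_tuple X)) => k k0 i.
rewrite -(coef_at_nth k i uX); apply: triv; last by rewrite mem_nth.
by rewrite sum_coef_at.
Qed.

End Dot.

(** * Connected sets with nonpositive inner products *)

Section Obtuse.
Variables (R : realType) (d : nat).
Local Notation V := 'rV[R]_d.
Implicit Types (T : {fset V}) (c : V -> R).

Definition obtuse T : Prop :=
  forall s t, s \in T -> t \in T -> s != t -> dot s t <= 0.

(** Connectedness of the graph of nonzero inner products on [T], stated as an
    induction principle: a predicate that holds somewhere in [T] and never
    separates two non-orthogonal points holds on all of [T]. *)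
Definition orth_connected T : Prop :=
  forall P : pred V,
    (exists2 x, x \in T & P x) ->
    (forall x y, x \in T -> y \in T -> P x -> ~~ P y -> dot x y = 0) ->
    forall x, x \in T -> P x.

(** The two parts of a join are orthogonal, so by connectedness one of them is
    everything; a point of the other part would then be orthogonal to itself. *)
Lemma orth_connected_J_prime (M : {vspace V}) T :
  (forall x, x \in T -> unit_sphere x) -> orth_connected T -> J_prime M T.
Proof.
move=> uT cT [L [X [[_ _ orL] _ X0 XL TX]]].
have XT i x : x \in X i -> x \in T.
  move=> xX; suff : [set` T] x by [].
  by rewrite TX; exists i.
have /fset0Pn[x0 x0X] := X0 0; have /fset0Pn[y yX] := X0 1.
have y0 : y \in X 0.
  apply: (cT (fun x => x \in X 0)); last exact: XT yX.
    by exists x0 => //; exact: XT x0X.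
  move=> x z xT zT xX zX.
  have : [set` T] z by [].
  rewrite TX => -[i _ /= zi].
  apply: (orL 0 i); [|exact: XL|exact: XL].
  by apply: contraNneq zX => ->.
have := unit_sphere_dot (uT _ (XT _ _ y0)).
rewrite (orL 0 1) //; [|exact: XL|exact: XL].
by move/eqP; rewrite eq_sym oner_eq0.
Qed.

(** Compare the expansions of the two squared norms: the diagonal terms agree,
    and off the diagonal [|c_s c_t| >= c_s c_t] is multiplied by a nonpositive
    number. *)
Lemma obtuse_abs_relation T c : obtuse T ->
  \sum_(t <- T) c t *: t = 0 -> \sum_(t <- T) `|c t| *: t = 0.
Proof.
move=> oT c0; apply: dot_eq0; apply/eqP; rewrite eq_le dot_ge0 andbT.
have := dot0l (0 : V); rewrite -{1 2}c0 => <-.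
rewrite !dot_suml big_seq [leRHS]big_seq; apply: ler_sum => s sT.
rewrite !dot_sumr big_seq [leRHS]big_seq; apply: ler_sum => t tT.
rewrite !dotZl !dotZr !mulrA -!normrM.
have [->|st] := eqVneq s t.
  by rewrite -expr2 ger0_norm ?sqr_ge0.
by rewrite ler_wnM2r ?ler_norm //; exact: oT.
Qed.

(** If [c_y = 0], the inner product of [y] with the vanishing vector
    [sum |c_t| t] is a sum of nonpositive terms, so [y] is orthogonal to every
    point where [c] is nonzero; connectedness applied to the support of [c]
    concludes. *)
Lemma connected_relation_support T c : obtuse T -> orth_connected T ->
  \sum_(t <- T) c t *: t = 0 -> (exists2 t, t \in T & c t != 0) ->
  forall t, t \in T -> c t != 0.
Proof.
move=> oT cT c0 ex; apply: cT ex _ => x y xT yT cx /negPn/eqP cy.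
have /(congr1 (fun z => dot z y)) := obtuse_abs_relation oT c0.
rewrite dot0l dot_suml => /eqP.
under eq_bigr do rewrite dotZl.
rewrite -oppr_eq0 -sumrN big_seq psumr_eq0 => [/allP/(_ x xT)|t tT].
  by rewrite xT /= oppr_eq0 mulf_eq0 normr_eq0 (negbTE cx) => /eqP.
rewrite oppr_ge0; have [->|ty] := eqVneq t y; first by rewrite cy normr0 mul0r.
by rewrite mulr_ge0_le0 ?oT.
Qed.

(** Without one of its points [t0], the set is free: a relation among the
    others extends by zero to a relation that misses [t0]. *)
Lemma card_le_dim_span T : obtuse T -> orth_connected T ->
  (#|` T| <= (\dim <<enum_fset T>>).+1)%N.
Proof.
move=> oT cT; have [->|/fset0Pn[t0 t0T]] := eqVneq T fset0.
  by rewrite cardfs0.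
pose X := [seq t <- T | t != t0].
have uX : uniq X by rewrite filter_uniq ?fset_uniq.
have fX : free X.
  apply: free_relations => // c c0 t tX; apply/eqP/negPn/negP => ct.
  have : \sum_(t <- T) (if t == t0 then 0 else c t) *: t = 0.
    rewrite -[RHS]c0 big_filter [RHS]big_mkcond; apply: eq_bigr => s _.
    by case: eqP => //; rewrite scale0r.
  move: tX; rewrite mem_filter => /andP[tt0 tT].
  move=> /(connected_relation_support oT cT)/(_ _ _ t0T).
  rewrite eqxx => H; suff : (0 : R) != 0 by rewrite eqxx.
  by apply: H; exists t => //; rewrite (negbTE tt0).
have <- : (size X).+1 = #|` T|.
  have := count_predC (pred1 t0) T; rewrite size_filter.
  by rewrite count_uniq_mem ?fset_uniq // (_ : _ \in _ = true) // => <-.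
rewrite ltnS -(eqP fX); apply: dimvS; apply: sub_span => t.
by rewrite mem_filter => /andP[].
Qed.

Lemma positive_relation T : obtuse T -> orth_connected T ->
  ~~ free (enum_fset T) ->
  exists lam : V -> R, [/\ forall t, t \in T -> 0 < lam t,
    \sum_(t <- T) lam t = 1 & \sum_(t <- T) lam t *: t = 0].
Proof.
move=> oT cT /negP nfr.
have [c c0 [t tT ct]] : exists2 c : V -> R, \sum_(t <- T) c t *: t = 0 &
    exists2 t, t \in T & c t != 0.
  apply: contrapT => nc; apply: nfr; apply: free_relations => [|c c0 t tT].
    exact: fset_uniq.
  by apply: contrapT => /eqP ct; apply: nc; exists c => //; exists t.
have cn0 := connected_relation_support oT cT c0 (ex_intro2 _ _ t tT ct).
pose N := \sum_(t <- T) `|c t|.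
have N0 : 0 < N.
  rewrite lt_neqAle sumr_ge0 // andbT eq_sym psumr_eq0 //.
  by apply/negP => /allP/(_ t tT); rewrite normr_eq0 (negbTE ct).
exists (fun t => N^-1 * `|c t|); split=> [s sT||].
- by rewrite mulr_gt0 ?invr_gt0 ?normr_gt0 ?cn0.
- by rewrite -mulr_sumr mulVf ?gt_eqF.
- under eq_bigr do rewrite -scalerA.
  by rewrite -scaler_sumr (obtuse_abs_relation oT c0) scaler0.
Qed.

Lemma linear_form_continuous (f : {linear V -> R^o}) : continuous (f : V -> R).
Proof.
have -> : (f : V -> R) = fun x => \sum_(j < d) x 0 j * f (delta_mx 0 j).
  apply/funext => x; rewrite {1}[x]row_sum_delta linear_sum.
  by apply: eq_bigr => j _; rewrite linearZ.
apply: (@continuous_big R^o _ _ _ _ (@add_continuous R^o)) => j _ x.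
exact: (cvgM (@coord_continuous R 1 d 0 j x) (cvg_cst _)).
Qed.

(** Coordinates in a spanning family depend continuously on the vector and can
    be shifted by multiples of [lam] to make them sum to [1]. The resulting
    weights equal [lam] at the origin, which places the origin inside the
    convex hull when [lam] is positive. *)
Lemma barycentric_weights T lam :
  \sum_(t <- T) lam t = 1 -> \sum_(t <- T) lam t *: t = 0 ->
  exists w : V -> V -> R,
    [/\ forall t, continuous (w t), forall t, w t 0 = lam t
      & forall x, x \in <<enum_fset T>>%VS ->
          \sum_(t <- T) w t x = 1 /\ x = \sum_(t <- T) w t x *: t].
Proof.
move=> lam1 lam0; pose X := in_tuple (enum_fset T).
pose g t x := coef_at (fun i : 'I_(size (enum_fset T)) => coord X i x) t.
have gc t : continuous (g t).
  apply: (@continuous_big R^o _ _ _ _ (@add_continuous R^o)) => j _.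
  exact: linear_form_continuous.
have sgc : continuous (fun x => \sum_(t <- T) g t x).
  by apply: (@continuous_big R^o _ _ _ _ (@add_continuous R^o)) => t _; exact: gc.
have g0 t : g t 0 = 0.
  by rewrite /g /coef_at big1 // => j _; rewrite linear0.
exists (fun t x => g t x + (1 - \sum_(s <- T) g s x) * lam t); split.
- move=> t x; apply: (cvgD (gc t x)).
  by apply: cvgM (cvg_cst _); apply: (cvgB (cvg_cst _) (sgc x)).
- by move=> t; rewrite g0 big1 // subr0 add0r mul1r.
- move=> x xT; split.
    by rewrite big_split /= -mulr_sumr lam1 mulr1 addrC subrK.
  under eq_bigr do rewrite scalerDl -scalerA.
  rewrite big_split /= -scaler_sumr lam0 scaler0 addr0.
  by rewrite sum_coef_at ?fset_uniq //; exact: coord_span.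
Qed.

(** The barycentric weights built from a positive relation sum to [1], so the
    affine hull is the whole span; they are positive at the origin, hence near
    it, so the convex hull is a neighbourhood of the origin in the span. *)
Lemma dependent_type_I T : (forall x, x \in T -> unit_sphere x) ->
  obtuse T -> orth_connected T ->
  (\dim <<enum_fset T>> < #|` T|)%N -> type_I <<enum_fset T>>%VS T.
Proof.
move=> uT oT cT ltT.
have nfT : ~~ free (enum_fset T).
  by rewrite /free -[size _]/(#|` T|) ltn_eqF.
have [lam [lam_gt0 lam1 lam0]] := positive_relation oT cT nfT.
have [w [wc w0 wE]] := barycentric_weights lam1 lam0.
split.
- exact: orth_connected_J_prime.
- by move=> x xT; split; [exact: memv_span|exact: uT].
- by apply/eqP; rewrite eqn_leq card_le_dim_span.
- exists 0, <<enum_fset T>>%VS; split=> //; apply/seteqP; split=> x /=.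
    move=> [c [_ ->]]; exists (\sum_(t <- T) c t *: t); rewrite ?add0r //.
    rewrite big_seq; apply: memv_suml => t tT.
    by apply: memvZ; exact: memv_span.
  move=> [y yT <-]; rewrite add0r; have [] := wE y yT.
  by exists (w^~ y).
- split; first exact: mem0v.
  have pos : \forall x \near (0 : V), forall t : T, 0 < w (val t) x.
    apply: (@filter_forall _ T (fun t x => 0 < w (val t) x) (nbhs (0 : V))) => t.
    have := wc (val t) 0; rewrite /continuous_at w0 => /cvgr_gt; apply.
    by apply: lam_gt0; exact: fsvalP.
  apply: filterS pos => x wx xT; have [w1 ->] := wE x xT.
  exists (w^~ x); split=> // t tT.
  by apply: ltW; exact: (wx [` tT]%fset).
Qed.

End Obtuse.
(** * Orthogonal components and the spaces that carry them *)

Section Components.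
Variables (R : realType) (d : nat).
Local Notation V := 'rV[R]_d.
Implicit Types (S T : {fset V}).

Lemma orth_components S :
  exists m (T : 'I_m -> {fset V}),
    [/\ forall i, T i != fset0, forall i, orth_connected (T i),
        forall i j x y, i != j -> x \in T i -> y \in T j -> dot x y = 0,
        forall x, x \in S <-> exists i, x \in T i
      & (\sum_(i < m) #|` T i|)%N = #|` S|].
Proof.
pose e : rel S := fun x y => dot (val x) (val y) != 0.
have esym : connect_sym e by apply: sym_connect_sym => x y; rewrite /e dotC.
pose I := {r : S | fingraph.roots e r}.
pose p (u : S) : 'I_#|{: I}| :=
  enum_rank (Sub (fingraph.root e u) (roots_root esym u) : I).
have pE u v : (p u == p v) = connect e u v.
  by rewrite (inj_eq enum_rank_inj) -val_eqE /= root_connect.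
have p_onto i : exists u, p u = i.
  exists (val (enum_val i)); rewrite -[RHS]enum_valK; congr enum_rank.
  by apply: val_inj => /=; apply/eqP; exact: valP (enum_val i).
pose T i := [fset val u | u in [pred u : S | p u == i]]%fset.
have TP i (u : S) : (val u \in T i) = (p u == i).
  apply/imfsetP/idP => [[v /= pv /val_inj ->] //|pu].
  by exists u.
have TS i x : x \in T i -> exists2 u : S, x = val u & p u = i.
  by move=> /imfsetP[u /= /eqP pu ->]; exists u.
exists #|{: I}|, T; split.
- move=> i; have [u pu] := p_onto i.
  by apply/fset0Pn; exists (val u); rewrite TP pu.
- move=> i P [x0 /TS[u0 -> pu0] Pu0] sep x /TS[u -> pu].
  pose a := [pred v : S | (p v == i) && P (val v)].
  have acl : fingraph.closed e a.
    move=> v v' evv'; rewrite !inE.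
    have -> : p v' = p v by apply/eqP; rewrite pE esym connect1.
    case: eqP => //= pv.
    have vT : val v \in T i by rewrite TP pv.
    have v'T : val v' \in T i by rewrite TP -pv pE esym connect1.
    apply/idP/idP => Pv; apply: contraT => nPv.
      by move: evv'; rewrite /e (sep _ _ vT v'T Pv nPv) eqxx.
    by move: evv'; rewrite /e dotC (sep _ _ v'T vT Pv nPv) eqxx.
  have /(closed_connect acl) : connect e u0 u by rewrite -pE pu0 pu.
  by rewrite !inE pu0 pu eqxx Pu0 /= => <-.
- move=> i j x y ij /TS[u -> pu] /TS[v -> pv].
  apply/eqP/negPn/negP => euv; move: ij.
  by rewrite -pu -pv pE connect1.
- move=> x; split=> [xS|[i /TS[u -> _]]]; last exact: fsvalP.
  by exists (p [` xS]%fset); rewrite -[x]/(val [` xS]%fset) TP eqxx.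
- rewrite cardfE -[RHS]sum1_card [RHS](partition_big p xpredT) //=.
  apply: eq_bigr => i _; rewrite sum1_card.
  rewrite card_in_imfset /= => [|u v _ _ /val_inj //].
  by rewrite -cardE.
Qed.

(** Induction on the codimension of the sum of the [L i]: if it is positive,
    then [d <= sum N] leaves room in some [L i0], which receives a nonzero
    vector orthogonal to all the spaces. Bounding each dimension separately is
    what spreads the new directions over different spaces. *)
Lemma enlarge_to_full m (N : 'I_m -> nat) (L : 'I_m -> {vspace V}) :
  (forall i j, i != j -> orthogonal_spaces (L i) (L j)) ->
  (forall i, (\dim (L i) <= N i)%N) -> (d <= \sum_(i < m) N i)%N ->
  exists L' : 'I_m -> {vspace V},
    [/\ forall i, (L i <= L' i)%VS,
        forall i j, i != j -> orthogonal_spaces (L' i) (L' j),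
        forall i, (\dim (L' i) <= N i)%N
      & (\sum_(i < m) L' i)%VS = fullv].
Proof.
move=> + + dN; have [n] := ubnP (d - \dim (\sum_(i < m) L i))%N.
elim: n L => // n IH L ltn orL leN.
have [full|nfull] := eqVneq (\sum_(i < m) L i)%VS fullv; first by exists L.
have dimF : \dim {: V} = d by rewrite dimvf /dim /= mul1n.
have dimL : \dim (\sum_(i < m) L i) = (\sum_(i < m) \dim (L i))%N.
  exact/directvP/orthogonal_directv.
have ltd : (\dim (\sum_(i < m) L i) < d)%N.
  have := dimvS (subvf (\sum_(i < m) L i)); rewrite dimF leq_eqVlt.
  case/orP=> // /eqP eqd; case/eqP: nfull; apply/eqP.
  by rewrite eqEdim subvf dimF eqd leqnn.
have [i0 lti0] : exists i0, (\dim (L i0) < N i0)%N.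
  apply: contrapT => /forallNP nlt; move: ltd; rewrite ltnNge dimL.
  case/negP; apply: leq_trans dN _; apply: leq_sum => i _.
  by rewrite leqNgt; apply/negP.
have [w w0 worth] := exists_orthogonal nfull.
have wL i u : u \in L i -> dot u w = 0.
  by move=> uL; apply: worth; apply: subvP uL; exact: sumv_sup.
pose L1 i := if i == i0 then (L i + <[w]>)%VS else L i.
have LL1 i : (L i <= L1 i)%VS by rewrite /L1; case: eqP => // _; exact: addvSl.
have orL1w i j u v : i != j -> u \in L1 i -> v \in L j -> dot u v = 0.
  move=> ij; rewrite /L1; case: (i == i0); last exact: (orL i j ij u v).
  move=> /memv_addP[u1 u1L [u2 /vlineP[a ->] ->]] vL.
  by rewrite dotDl (orL i j ij) // dotZl dotC (wL _ _ vL) mulr0 addr0.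
have [|||L2 [L12 orL2 leN2 full2]] := IH L1.
- rewrite -ltnS; apply: leq_trans ltn; apply: ltn_sub2l => //.
  rewrite ltnNge; apply/negP => le21.
  have LS : (\sum_(i < m) L i <= \sum_(i < m) L1 i)%VS.
    by apply/subv_sumP => i _; apply: subv_trans (LL1 i) _; exact: sumv_sup.
  have eqS : (\sum_(i < m) L i)%VS = (\sum_(i < m) L1 i)%VS.
    by apply/eqP; rewrite eqEdim LS.
  have wS : w \in (\sum_(i < m) L i)%VS.
    rewrite eqS; have : w \in L1 i0.
      by rewrite /L1 eqxx; apply: subvP (memv_line w); exact: addvSr.
    by apply: subvP; exact: sumv_sup.
  by move/eqP: w0; apply; apply: dot_eq0; exact: worth.
- move=> i j ij u v uL; rewrite {1}/L1; case: eqP => [jE|_].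
    move=> vL; rewrite dotC; apply: (orL1w j i) => //; first by rewrite eq_sym.
      by rewrite /L1 jE eqxx -jE.
    by move: uL; rewrite /L1 -jE (negbTE ij).
  by apply: (orL1w i j).
- move=> i; rewrite /L1; case: eqP => [->|_]; last exact: leN.
  apply: leq_trans (leq_of_leqif (dimv_add_leqif _ _)) _; rewrite dim_vline w0 addn1.
  exact: lti0.
by exists L2; split=> // i; exact: subv_trans (LL1 i) (L12 i).
Qed.

End Components.

(** * Decomposition of the set *)

Lemma sqrt2_apart_obtuse (R : realType) (d : nat) (S : {fset 'rV[R]_d})
    (a b : R) :
  (forall x, x \in S -> unit_sphere x) ->
  two_distance_set a b S -> a = Num.sqrt 2 -> obtuse S.
Proof.
move=> uS [ab S2] aE x y xS yS xy.
have : Num.sqrt 2 <= Defs.edist x y.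
  by rewrite -aE; case: (S2 x y xS yS xy) => ->.
rewrite ler_sqrt ?dot_ge0 // -scaleN1r dotDl !dotDr !dotZl !dotZr.
rewrite (unit_sphere_dot (uS x xS)) (unit_sphere_dot (uS y yS)) (dotC y x).
lra.
Qed.

Theorem theorem5p4 (R : realType) (d k : nat) (S : {fset 'rV[R]_d}) (a b : R)
  (hk : (1 <= k)%N)
  (hsphere : forall x, x \in S -> unit_sphere x)
  (htwo : two_distance_set a b S)
  (ha : a = Num.sqrt 2)
  (hcard : #|` S| = (d + k)%N) :
  exists (m : nat) (L : 'I_m -> {vspace 'rV[R]_d}) (T : 'I_m -> {fset 'rV[R]_d}),
    [/\ is_join fullv S L T,
        forall i, J_prime (L i) (T i)
      & #|[set i : 'I_m | `[< type_I (L i) (T i) >]]%SET| = k].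
Proof.
have oS := sqrt2_apart_obtuse hsphere htwo ha.
have [m [T [T0 cT orT ST cardT]]] := orth_components S.
have TS i x : x \in T i -> x \in S by move=> xT; apply/ST; exists i.
have uT i x : x \in T i -> unit_sphere x by move=> /TS; exact: hsphere.
have oT i : obtuse (T i) by move=> x y /TS xS /TS yS; exact: oS.
have orspan i j : i != j ->
    orthogonal_spaces <<enum_fset (T i)>>%VS <<enum_fset (T j)>>%VS.
  move=> ij u v /(coord_span (X := in_tuple _)) ->.
  move=> /(coord_span (X := in_tuple _)) ->.
  rewrite dot_suml big1 // => s _; rewrite dot_sumr big1 // => t _.
  by rewrite dotZl dotZr (orT i j) ?mulr0 //; exact: mem_nth.
have [||L [spanL orL leL full]] := enlarge_to_full (N := fun i => #|` T i|) orspan.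
- by move=> i; exact: dim_span.
- by rewrite cardT hcard leq_addr.
have TL i x : x \in T i -> x \in L i.
  by move=> xT; apply: subvP (spanL i) _ _; exact: memv_span.
exists m, L, T; split.
- split=> //.
  + by split=> //; exact: orthogonal_directv.
  + move=> i; have /fset0Pn[x xT] := T0 i; apply/eqP => Li0.
    have := TL i x xT; rewrite Li0 memv0 => /eqP x0.
    have /eqP := unit_sphere_dot (uT i x xT).
    by rewrite x0 dot0l eq_sym oner_eq0.
  + apply/seteqP; split=> x /=; first by move=> /ST[i xT]; exists i.
    by move=> [i _ xT]; apply/ST; exists i.
- by move=> i; apply: orth_connected_J_prime (cT i); exact: uT.
have leS i : (#|` T i| <= (\dim (L i)).+1)%N.
  by apply: leq_trans (card_le_dim_span (oT i) (cT i)) _; rewrite ltnS dimvS.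
have typeE i : `[< type_I (L i) (T i) >] = (\dim (L i) < #|` T i|)%N.
  apply/asboolP/idP => [[_ _ -> _ _] //|ltL].
  have -> : L i = <<enum_fset (T i)>>%VS.
    apply/esym/eqP; rewrite eqEdim spanL -ltnS.
    exact: leq_trans ltL (card_le_dim_span (oT i) (cT i)).
  apply: dependent_type_I => //; first exact: uT.
  exact: leq_ltn_trans (dimvS (spanL i)) ltL.
have dimL : (\sum_(i < m) \dim (L i))%N = d.
  rewrite -(directvP (orthogonal_directv orL)) /= full.
  by rewrite dimvf /dim /= mul1n.
(* Add [d], the sum of the dimensions, to both sides: the claim becomes
   [dim L_i + (1 if dim L_i < |T_i|) = |T_i|], summed over [i]. *)
apply: (@addnI d); rewrite -hcard -cardT -{1}dimL -sum1dep_card.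
rewrite [X in (_ + X)%N]big_mkcond -big_split /=; apply: eq_bigr => i _.
rewrite typeE.
have := leS i; have := leL i; rewrite leq_eqVlt => /orP[/eqP ->|ltL leS'].
  by rewrite ltnn addn0.
by rewrite ltL addn1; apply/eqP; rewrite eqn_leq ltL leS'.
Qed.
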